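(* Let $G^v$ and $H^w$ be finite simple rooted graphs (rooted at $v$ and $w$ respectively). For all integers $k \geq 2$, \[ I\bigl((G^v:H^w)_k;x\bigr) = \bigl( I(H\setminus w;x) + I(H;x) \bigr)\, I\bigl((G^v:H^w)_{k-1};x\bigr) - I(H\setminus w;x)\,I(H;x)\, I\bigl((G^v:H^w)_{k-2};x\bigr). \] That is, the sequence $\bigl(I((G^v:H^w)_k;x)\bigr)_{k\ge 0}$ satisfies a linear recurrence with characteristic polynomial $\chi(r) = \bigl(r - I(H\setminus w;x)\bigr)\bigl(r - I(H;x)\bigr)$.
   Context: All graphs are finite and simple. The independence polynomial of a graph $G$ is $I(G;x)=\sum_{i\ge 0} s_i x^i$, where $s_i$ is the number of independent sets of size $i$ in $G$ (so $s_0=1$, and the empty graph has independence polynomial $1$). A rooted graph $G^v$ is a graph $G$ with a distinguished vertex $v$. $G\setminus v$ denotes $G$ with $v$ deleted, and $G\setminus N[v]$ denotes $G$ with the closed neighborhood of $v$ deleted. For a rooted graph $H^w$ and an integer $k\ge 0$, the scale graph $Z_k(H^w)$ is obtained by taking a new vertex $v_0$ and $k$ disjoint copies of $H$ and joining $v_0$ to the root $w$ of each copy. For disjoint rooted graphs $G^v,H^w$, the graph $(G^v:H^w)_k$ is the disjoint union of $G$ and $Z_k(H^w)$ together with the edge joining $v$ to $v_0$; it is regarded as rooted at $v$. A sequence $(p_k)_{k\ge0}$ satisfies the linear recurrence with characteristic polynomial $r^n - c_{n-1}r^{n-1}-\cdots-c_0$ if $p_k = c_{n-1}p_{k-1}+\cdots+c_0p_{k-n}$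 for all $k\ge n$. *)

(* Defs.v *)
From mathcomp Require Import all_boot all_order all_algebra.

Set Implicit Arguments.
Unset Strict Implicit.
Unset Printing Implicit Defensive.

Import GRing.Theory.
Local Open Scope ring_scope.

Record sgraph := SGraph {
  vertex :> finType;
  edge : rel vertex;
  edge_sym : symmetric edge;
  edge_irrefl : irreflexive edge
}.

Record rooted_graph := RootedGraph {
  graph_of :> sgraph;
  graph_root : graph_of
}.

Definition independent (G : sgraph) (A : {set G}) : bool :=
  [forall x in A, forall y in A, ~~ edge x y].

Definition num_indep (G : sgraph) (i : nat) : nat :=
  #|[set A : {set G} | independent A & #|A| == i]|.

(* No independent set has more than #|G| elements, so this bound on the degree
   discards nothing. *)
Definition indep_poly (G : sgraph) : {poly int} :=
  \sum_(i < #|G|.+1) (num_indep G i)%:R *: 'X^i.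

Section Delete.
Variables (G : sgraph) (v : G).

Definition del_edge : rel {x : G | x != v} := fun x y => edge (val x) (val y).

Lemma del_edge_sym : symmetric del_edge.
Proof. by move=> x y; apply: edge_sym. Qed.

Lemma del_edge_irrefl : irreflexive del_edge.
Proof. by move=> x; apply: edge_irrefl. Qed.

Definition del_vertex : sgraph := SGraph del_edge_sym del_edge_irrefl.

End Delete.

(* In [scale_graph k H], [None] is the new vertex v_0 and [Some (i, h)] is the
   vertex h of the i-th copy of H. *)
Section Scale.
Variables (k : nat) (H : rooted_graph).

Definition scale_edge : rel (option ('I_k * H)) := fun x y =>
  match x, y with
  | None, None => false
  | None, Some (_, h) | Some (_, h), None => h == graph_root H
  | Some (i, h), Some (j, h') => (i == j) && edge h h'
  end.

Lemma scale_edge_sym : symmetric scale_edge.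
Proof.
by case=> [[i h]|] [[j h']|] //=; rewrite eq_sym edge_sym.
Qed.

Lemma scale_edge_irrefl : irreflexive scale_edge.
Proof. by case=> [[i h]|] //=; rewrite edge_irrefl andbF. Qed.

Definition scale_graph : sgraph := SGraph scale_edge_sym scale_edge_irrefl.

Definition scale_center : scale_graph := None.

End Scale.

(* (G^v : H^w)_k; the sum type makes the union of vertex sets disjoint. *)
Section Join.
Variables (G H : rooted_graph) (k : nat).

Definition join_edge : rel (G + scale_graph k H) := fun x y =>
  match x, y with
  | inl g, inl g' => edge g g'
  | inr z, inr z' => edge z z'
  | inl g, inr z | inr z, inl g => (g == graph_root G) && (z == scale_center k H)
  end.

Lemma join_edge_sym : symmetric join_edge.
Proof.
by case=> [g|z] [g'|z'] //; [apply: edge_sym | apply: scale_edge_sym].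
Qed.

Lemma join_edge_irrefl : irreflexive join_edge.
Proof.
by case=> [g|z]; [apply: edge_irrefl | apply: scale_edge_irrefl].
Qed.

Definition join_graph : rooted_graph :=
  @RootedGraph (SGraph join_edge_sym join_edge_irrefl) (inl (graph_root G)).

End Join.

Definition satisfies_linrec (R : comNzRingType) (chi : {poly R})
    (p : nat -> R) : Prop :=
  exists (n : nat) (c : 'I_n -> R),
    chi = 'X^n - \sum_(i < n) c i *: 'X^i
    /\ forall k : nat, (n <= k)%N ->
       p k = \sum_(i < n) c i * p (k - n + i)%N.

(* Main.v *)
(** Split the independent sets of [(G^v : H^w)_k] according to whether they
    contain the centre [v_0].  Those avoiding [v_0] consist of independent sets of
    [G] and of each copy of [H], chosen freely; those containing it consist of
    independent sets of [G] avoiding [v] and of each copy of [H] avoiding [w].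
    Hence the polynomial is [I(G) * I(H)^k + x * I(G \ v) * I(H \ w)^k], and any
    combination of the [k]-th powers of [p] and [q] satisfies the recurrence with
    characteristic polynomial [(r - p) (r - q)]. *)
Require Import Defs.
From mathcomp Require Import all_boot all_order all_algebra.
From mathcomp Require Import ring.

Set Implicit Arguments.
Unset Strict Implicit.
Unset Printing Implicit Defensive.

Import GRing.Theory.
Local Open Scope ring_scope.

Lemma independentP (G : sgraph) (A : {set G}) :
  reflect {in A &, forall x y, ~~ edge x y} (independent A).
Proof.
apply: (iffP forall_inP) => [indA x y xA yA | indA x xA].
  by have /forall_inP := indA x xA; apply.
by apply/forall_inP => y yA; apply: indA.
Qed.

(** Grouping the sets by cardinality gives back the coefficients. A sum over sets, unlike one over
    sizes, can be reindexed along bijections. *)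
Lemma indep_polyE (G : sgraph) :
  indep_poly G = \sum_(A : {set G} | independent A) 'X^#|A|.
Proof.
(* [inord] falls back to a default only above [#|G|], which no cardinality exceeds. *)
pose size_ord (A : {set G}) : 'I_#|G|.+1 := inord #|A|.
rewrite (partition_big size_ord xpredT) //=; apply: eq_bigr => i _.
have sizeE A : (size_ord A == i) = (#|A| == i).
  by rewrite -val_eqE /= inordK // ltnS max_card.
rewrite (eq_bigr (fun=> 'X^i)); last first.
  by move=> A /andP[_ Ai]; congr 'X^_; apply/eqP; rewrite -sizeE.
rewrite sumr_const scaler_nat /num_indep cardsE; congr (_ *+ _).
by apply: eq_card => A; rewrite -!topredE /= sizeE.
Qed.

(** Taking images under [val] matches the independent sets of the deleted graph with those of [G]
    avoiding [v], preserving size; deletion thus becomes a side condition on sets of [G]. *)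
Lemma indep_poly_del (G : sgraph) (v : G) :
  indep_poly (del_vertex v) =
  \sum_(A : {set G} | independent A && (v \notin A)) 'X^#|A|.
Proof.
rewrite indep_polyE.
pose emb (B : {set del_vertex v}) : {set G} := [set val x | x in B].
pose res (A : {set G}) : {set del_vertex v} := [set x | val x \in A].
have embK : cancel emb res.
  by move=> B; apply/setP=> x; rewrite inE mem_imset //; apply: val_inj.
have v_emb B : v \notin emb B.
  by apply/imsetP=> -[x _ vE]; have := valP x; rewrite -vE eqxx.
rewrite [RHS](reindex_onto emb res) => [|A /andP[_ vA]].
  apply: eq_big => [B | B _]; last by rewrite card_imset //; apply: val_inj.
  rewrite embK eqxx v_emb !andbT; apply/independentP/independentP => indB.
    by move=> _ _ /imsetP[x xB ->] /imsetP[y yB ->]; apply: (indB x y).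
  by move=> x y xB yB; apply: (indB (val x) (val y)); apply: imset_f.
(* It remains that [emb (res A) = A], which holds because [A] avoids [v]. *)
apply/setP=> x; apply/imsetP/idP => [[y] | xA]; first by rewrite inE => ? ->.
have xv : x != v by apply: contraNneq vA => <-.
by exists (Sub x xv); rewrite ?inE.
Qed.

Section JoinSets.
Variables (G H : rooted_graph) (k : nat).

Definition join_set (t : {set G} * {ffun 'I_k -> {set H}} * bool) :
    {set join_graph G H k} :=
  [set x : G + option ('I_k * H) | match x with
    | inl g => g \in t.1.1
    | inr None => t.2
    | inr (Some (i, h)) => h \in t.1.2 i
    end].

Lemma join_set_bij : bijective join_set.
Proof.
pose split (A : {set join_graph G H k}) : {set G} * {ffun 'I_k -> {set H}} * bool :=
  ([set g | inl g \in A], [ffun i => [set h | inr (Some (i, h)) \in A]],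
   inr None \in A).
exists split => [[[B F] b] | A].
  congr (_, _, _); last by rewrite inE.
    by apply/setP=> g; rewrite !inE.
  by apply/ffunP=> i; rewrite ffunE; apply/setP=> h; rewrite !inE.
by apply/setP=> -[g|[[i h]|]]; rewrite !inE //= ?ffunE inE.
Qed.

Lemma card_join_set B F b :
  #|join_set (B, F, b)| = (#|B| + (b + \sum_i #|F i|))%N.
Proof.
rewrite -sum1_card big_mkcond /= big_sumType /=; congr (_ + _)%N.
  by rewrite -sum1_card [RHS]big_mkcond; apply: eq_bigr => g _; rewrite inE.
rewrite (bigD1 None) //= inE /=; congr (_ + _)%N.
rewrite (reindex_omap Some id) /=; last by case.
under [RHS]eq_bigr do rewrite -sum1_card big_mkcond.
by rewrite pair_big; apply: eq_big => -[i h] *; rewrite ?inE /= ?eqxx.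
Qed.

(** Edges between different pieces all meet the centre, so the pieces constrain each other only
    through [b]: a chosen centre forbids the roots. *)
Lemma independent_join_set B F b :
  independent (join_set (B, F, b)) =
  (independent B && (b ==> (graph_root G \notin B))) &&
  [forall i, independent (F i) && (b ==> (graph_root H \notin F i))].
Proof.
apply/independentP/andP => [indA | [/andP[/independentP indB bB] /forallP indF]].
  split.
    apply/andP; split.
      by apply/independentP => x y xB yB; apply: (indA (inl x) (inl y)); rewrite inE.
    apply/implyP=> bT; apply/negP=> vB.
    have := indA (inl (graph_root G)) (inr None).
    by rewrite !inE /= !eqxx => /(_ vB bT).
  apply/forallP=> i; apply/andP; split.
    apply/independentP => x y xF yF.
    have := indA (inr (Some (i, x))) (inr (Some (i, y))).
    by rewrite !inE /= eqxx; apply.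
  apply/implyP=> bT; apply/negP=> wF.
  have := indA (inr None) (inr (Some (i, graph_root H))).
  by rewrite !inE /= eqxx => /(_ bT wF).
have centerF i h : b -> h \in F i -> h != graph_root H.
  by move=> bT hF; case/andP: (indF i) => _; rewrite bT; apply: contraNneq => <-.
have centerB g : b -> g \in B -> g != graph_root G.
  by move=> bT gB; move: bB; rewrite bT; apply: contraNneq => <-.
case=> [g|[[i h]|]] [g'|[[j h']|]]; rewrite !inE //=.
- exact: indB.
- by move=> _ _; rewrite andbF.
- by move=> gB bT; rewrite (negPf (centerB g bT gB)).
- by move=> _ _; rewrite andbF.
- case: eqP => //= -> hF h'F.
  by have /andP[/independentP indFj _] := indF j; apply: indFj.
- by move=> hF bT; apply: centerF bT hF.
- by move=> bT gB; rewrite (negPf (centerB g' bT gB)).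
- exact: centerF.
Qed.

End JoinSets.

Lemma indep_poly_join (G H : rooted_graph) (k : nat) :
  indep_poly (join_graph G H k) =
    indep_poly G * indep_poly H ^+ k
    + 'X * indep_poly (del_vertex (graph_root G))
      * indep_poly (del_vertex (graph_root H)) ^+ k.
Proof.
(* Both cases for the centre are handled at once: the root condition is vacuous for [b = false]. *)
pose PG (b : bool) B := independent B && (b ==> (graph_root G \notin B)).
pose PH (b : bool) C := independent C && (b ==> (graph_root H \notin C)).
have sumE b :
    \sum_(BF : {set G} * {ffun 'I_k -> {set H}} | independent (join_set (BF, b)))
      'X^#|join_set (BF, b)|
    = 'X^b * (\sum_(B | PG b B) 'X^#|B|) * (\sum_(C | PH b C) 'X^#|C|) ^+ k
    :> {poly int}.
  rewrite -[k in RHS]card_ord -prodr_const.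
  (* Distributivity turns the product of [k] sums into one sum over families [F], one set per copy
     of [H]. *)
  rewrite (eq_bigl (fun i : 'I_k => true)) // bigA_distr_big /=.
  rewrite -mulrA big_distrlr /= pair_big /= big_distrr /=.
  apply: eq_big => [[B F]|[B F] _] /=.
    by rewrite independent_join_set; congr (_ && _); apply/forallP/ffun_onP.
  by rewrite card_join_set !exprD expr_sum mulrCA.
rewrite indep_polyE (reindex (@join_set G H k)); last exact/onW_bij/join_set_bij.
rewrite -(pair_big_dep xpredT (fun BF b => independent (join_set (BF, b)))
  (fun BF b => 'X^#|join_set (BF, b)|)) /=.
rewrite (exchange_big_dep xpredT) //= big_bool /= !sumE /PG /PH /= addrC.
rewrite !indep_poly_del !indep_polyE expr0 mul1r.
by congr (_ * _ ^+ _ + _); apply: eq_bigl => A; rewrite andbT.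
Qed.

Lemma sum_powers_rec (R : comNzRingType) (a b p q : R) (s : nat -> R) :
    (forall k, s k = a * p ^+ k + b * q ^+ k) ->
  forall k, (2 <= k)%N ->
    s k = (q + p) * s (k - 1)%N - q * p * s (k - 2)%N.
Proof.
(* Writing the index as [k.+2] removes the truncated subtractions. *)
by move=> sE [|[|k]] // _; rewrite subn2 subn1 /= !sE !exprS; ring.
Qed.

Theorem theorem2p2 (G H : rooted_graph) :
  (forall k : nat, (2 <= k)%N ->
     indep_poly (join_graph G H k) =
       (indep_poly (del_vertex (graph_root H)) + indep_poly H)
         * indep_poly (join_graph G H (k - 1))
       - indep_poly (del_vertex (graph_root H)) * indep_poly H
         * indep_poly (join_graph G H (k - 2)))
  /\ satisfies_linrec
       (('X - (indep_poly (del_vertex (graph_root H)))%:P)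
          * ('X - (indep_poly H)%:P))
       (fun k : nat => indep_poly (join_graph G H k)).
Proof.
have rec := sum_powers_rec (indep_poly_join G H).
split=> //; set q := indep_poly (del_vertex _) in rec *.
set p := indep_poly H in rec *.
(* The coefficients are read off [(r - q)(r - p) = r^2 - ((q + p) r - q p)]; index 0 goes with the
   term at [k - 2]. *)
exists 2, (fun i : 'I_2 => if i == 0 then - (q * p) else q + p); split=> [|k k2].
  rewrite big_ord_recl big_ord1 /= expr0 expr1 -!mul_polyC.
  by rewrite !(rmorphN, rmorphD, rmorphM) /=; ring.
rewrite big_ord_recl big_ord1 /= addn0 rec //.
have -> : (k - 2 + bump 0 0 = k - 1)%N by rewrite /bump /= addn1 -subSn.
by ring.
Qed.
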